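(* Each of the following families of games is pet and returnable but not forced: Pawn on the set of all nonempty partitions; Knight on the set of all rectangles; King on the set of all staircases; Pawn on the set of all staircases; Downright on the set of all nonempty subpartitions of generalized staircases.
   Context: A partition is a finite weakly decreasing sequence $\lambda=[\lambda_1,\ldots,\lambda_r]$ of positive integers; $[\,]$ is the empty partition, and $\mathbb Y^+$ is the set of nonempty partitions. For $i,j\ge 0$, $\lambda[i,j]=[\lambda_{i+1}-j,\lambda_{i+2}-j,\ldots]$ with trailing nonpositive entries removed. For a moveset $M\subseteq \mathbb Z_{\ge0}^2\setminus\{(0,0)\}$ and $\lambda\in\mathbb Y^+$, the impartial chess game $(M,\lambda)$ starts at $\lambda$, and from a position $\mu\in\mathbb Y^+$ a player may move to $\mu[i,j]$ for any $(i,j)\in M$ with $\mu[i,j]\ne[\,]$. The positions of $(M,\lambda)$ are the partitions reachable from $\lambda$ by zero or more moves. A position is terminal if it has no moves. Movesets: Downright $\{(0,1),(1,0)\}$; Pawn $\{(0,1),(1,1)\}$; Knight $\{(1,2),(2,1)\}$; King $\{(0,1),(1,0),(1,1)\}$. Rectangles are the partitions $[c^r]$ ($c$ repeated $r$ times), $r,c\ge1$; staircases are the partitions $[k,k-1,\ldots,1]$, $k\ge1$; the generalized staircase with parameters $r,c,k\ge1$ is $[(kc)^r,((k-1)c)^r,\ldots,c^r]$ (exponents denote repetition). A nonempty subpartition of a generalized staircase $\lambda$ is a partition $\lambda[i,j]\neq[\,]$ with $i,j\ge0$. The Sprague-Grundy value of a position $p$ is $\mathrm{mex}$ of the Sprague-Grundy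 values of the positions reachable in one move ($0$ if $p$ is terminal), where $\mathrm{mex}(S)$ is the least nonnegative integer not in $S$. The misère Grundy value is defined by the same mex recursion at non-terminal positions, but terminal positions have value $1$. A position with Sprague-Grundy value $t$ and misère Grundy value $\ell$ is called a $(t,\ell)$-position. A game is returnable if for any move from a $(0,1)$-position (resp. a $(1,0)$-position) to a non-terminal position $y$, there is a move from $y$ to a $(0,1)$-position (resp. to a $(1,0)$-position). A game is forced if each move from a $(0,1)$-position results in a $(1,0)$-position and each move from a $(1,0)$-position results in a $(0,1)$-position. A game is pet if it has only $(0,1)$-positions, $(1,0)$-positions, and $(k,k)$-positions with $k\ge2$. For a moveset $M$ and a set $P\subseteq\mathbb Y^+$, the family $(M,P)$ has one of these properties if $(M,\lambda)$ has it for every $\lambda\in P$, and it does not have the property if $(M,\lambda)$ fails it for at least one $\lambda\in P$. *)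

(* Defs.v *)
From mathcomp Require Import all_boot.
From Stdlib Require Import Relation_Operators.

Set Implicit Arguments.
Unset Strict Implicit.
Unset Printing Implicit Defensive.

Definition is_partition (s : seq nat) : bool :=
  sorted geq s && all (fun x => 0 < x) s.

Definition Yplus (s : seq nat) : bool := is_partition s && (s != [::]).

(* The part x - j is nonpositive exactly when its truncation is 0; in a weakly
   decreasing sequence all such entries are trailing. *)
Definition subpart (s : seq nat) (i j : nat) : seq nat :=
  [seq x <- [seq y - j | y <- drop i s] | 0 < x].

Lemma subpart_partition s i j : is_partition s -> is_partition (subpart s i j).
Proof.
case/andP=> s_sorted _; apply/andP; split; last exact: filter_all.
have geq_tr : transitive geq by move=> y x z /= yx zy; apply: leq_trans zy yx.
apply: sorted_filter => //; rewrite sorted_map.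
apply: (@sub_sorted _ geq) => [x y /= le_yx|]; first exact: leq_sub2r.
exact: drop_sorted.
Qed.

Record moveset := Moveset {
  moves :> pred (nat * nat);
  _ : ~~ moves (0, 0)
}.

Definition Downright : moveset :=
  @Moveset [pred m | m \in [:: (0, 1); (1, 0)]] isT.
Definition Pawn : moveset :=
  @Moveset [pred m | m \in [:: (0, 1); (1, 1)]] isT.
Definition Knight : moveset :=
  @Moveset [pred m | m \in [:: (1, 2); (2, 1)]] isT.
Definition King : moveset :=
  @Moveset [pred m | m \in [:: (0, 1); (1, 0); (1, 1)]] isT.

Definition move (M : moveset) (mu nu : seq nat) : Prop :=
  exists i j, [/\ M (i, j), nu = subpart mu i j & nu != [::]].

Definition terminal (M : moveset) (mu : seq nat) : Prop :=
  forall nu, ~ move M mu nu.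

Definition position (M : moveset) (lam mu : seq nat) : Prop :=
  clos_refl_trans (seq nat) (move M) lam mu.

(* The finitely many targets of [move M mu]: if i >= size mu or j >= mu_1 then
   mu[i,j] is empty (see [optionsP]). *)
Definition options (M : moveset) (mu : seq nat) : seq (seq nat) :=
  [seq nu <- [seq subpart mu m.1 m.2 |
                m <- [seq (i, j) | i <- iota 0 (size mu), j <- iota 0 (head 0 mu)]
                & M m]
   | nu != [::]].

Lemma optionsP M mu nu :
  is_partition mu -> reflect (move M mu nu) (nu \in options M mu).
Proof.
move=> mu_part; apply: (iffP idP) => [|[i [j [Mij -> ne]]]].
  rewrite mem_filter => /andP[ne /mapP[[i j]]].
  by rewrite mem_filter => /andP[Mij _] nuE; exists i, j.
rewrite mem_filter ne /=; apply/mapP; exists (i, j) => //.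
rewrite mem_filter Mij /=; apply/allpairsP; exists (i, j); split=> //=.
  rewrite mem_iota /= add0n ltnNge; apply: contra ne => le_mu_i.
  by rewrite /subpart drop_oversize.
rewrite mem_iota /= add0n ltnNge; apply: contra ne => le_head_j.
rewrite -size_eq0 size_filter -leqn0 leqNgt -has_count has_map.
apply/hasPn => x /mem_drop x_mu /=; rewrite -leqNgt leqn0 subn_eq0.
apply: leq_trans le_head_j; case: mu mu_part x_mu => //= a s /andP[pa _].
have geq_tr : transitive geq by move=> y z t /= yz ty; apply: leq_trans ty yz.
rewrite inE => /predU1P[->//|xs].
exact: (allP (order_path_min geq_tr pa)).
Qed.

Lemma options_sumn M mu nu : nu \in options M mu -> sumn nu < sumn mu.
Proof.
rewrite mem_filter => /andP[_ /mapP[[i j]]].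
rewrite mem_filter => /andP[Mij /allpairsP[[i' j'] /= [_ j'lt [iE jE]]] ->].
move: Mij; rewrite {}iE {}jE /= => Mij {i j}.
have sub_le s k : sumn (subpart s 0 k) <= sumn s.
  rewrite /subpart drop0; elim: s => //= x s IH.
  case: ifP => _ /=; first by rewrite leq_add ?leq_subr.
  exact: leq_trans IH (leq_addl _ _).
have subE s i0 k : subpart s i0 k = subpart (drop i0 s) 0 k.
  by rewrite /subpart drop0.
have drop_le s n : sumn (drop n s) <= sumn s.
  by rewrite -{2}(cat_take_drop n s) sumn_cat leq_addl.
case: mu j'lt => [//|a s]; rewrite mem_iota add0n /= => j'lt.
have a_gt0 : 0 < a by apply: leq_ltn_trans j'lt.
case: i' Mij => [|i'] Mij.
  case: j' j'lt Mij => [|j'] j'lt Mij; first by case: M Mij => /= p /negP.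
  have := sub_le s j'.+1; rewrite /subpart !drop0 /= subn_gt0 j'lt /= => le_s.
  by rewrite -addSn leq_add // ltn_subrL a_gt0.
rewrite subE /=; apply: leq_ltn_trans (sub_le _ _) _.
by apply: leq_ltn_trans (drop_le _ _) _; rewrite -[ltnLHS]add0n ltn_add2r.
Qed.

Definition mex (s : seq nat) : nat :=
  find (fun n => n \notin s) (iota 0 (size s).+1).

Lemma mexP s : mex s \notin s /\ forall n, n < mex s -> n \in s.
Proof.
have hs : has (fun n => n \notin s) (iota 0 (size s).+1).
  apply/negPn; rewrite -all_predC; apply/negP => /allP all_s.
  have : {subset iota 0 (size s).+1 <= s}.
    by move=> n /all_s /=; rewrite negbK.
  by move/(uniq_leq_size (iota_uniq _ _)); rewrite size_iota ltnn.
have lt_mex : mex s < (size s).+1 by rewrite -[ltnRHS](size_iota 0) -has_find.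
split=> [|n lt_n]; first by have := nth_find 0 hs; rewrite nth_iota.
have := before_find 0 lt_n; rewrite nth_iota ?(ltn_trans lt_n) //.
by move/negbFE.
Qed.

(* [t] is the value of terminal positions.  [n] is fuel: a move strictly
   decreases [sumn mu], so [sumn mu] suffices (see [grundyE]). *)
Fixpoint grundy_rec (M : moveset) (t n : nat) (mu : seq nat) : nat :=
  if options M mu is [::] then t
  else if n is n'.+1 then mex [seq grundy_rec M t n' nu | nu <- options M mu]
  else t.

Definition grundy (M : moveset) (t : nat) (mu : seq nat) : nat :=
  grundy_rec M t (sumn mu) mu.

Lemma grundyE M t mu :
  grundy M t mu = if options M mu is [::] then t
                  else mex [seq grundy M t nu | nu <- options M mu].
Proof.
have fuel m n nu : sumn nu <= m -> sumn nu <= n ->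
    grundy_rec M t m nu = grundy_rec M t n nu.
  elim: m n nu => [|m IH] [|n] nu //= le_m le_n.
  - case E: (options M nu) => [//|x s].
    have /options_sumn : x \in options M nu by rewrite E mem_head.
    by rewrite ltnNge (leq_trans le_m).
  - case E: (options M nu) => [//|x s].
    have /options_sumn : x \in options M nu by rewrite E mem_head.
    by rewrite ltnNge (leq_trans le_n).
  case E: (options M nu) => [//|x s]; rewrite -E.
  congr mex; apply/eq_in_map => y /options_sumn lt_y.
  by apply: IH; rewrite -ltnS; apply: leq_trans lt_y _.
rewrite {1}/grundy; case E: (options M mu) => [|x s].
  by case: (sumn mu) => [|n] /=; rewrite E.
have := @options_sumn M mu; case Es: (sumn mu) => [|n] /= lt_mu.
  by have := lt_mu x; rewrite E mem_head => /(_ isT).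
rewrite E -/(map _ (x :: s)) -E; congr mex; apply/eq_in_map => y /lt_mu; rewrite ltnS => lt_y.
exact: fuel.
Qed.

Definition sprague_grundy (M : moveset) (mu : seq nat) : nat := grundy M 0 mu.

Definition misere_grundy (M : moveset) (mu : seq nat) : nat := grundy M 1 mu.

Definition tl_position (M : moveset) (t l : nat) (mu : seq nat) : Prop :=
  sprague_grundy M mu = t /\ misere_grundy M mu = l.

Definition returnable (M : moveset) (lam : seq nat) : Prop :=
  forall x y, position M lam x -> move M x y -> ~ terminal M y ->
    (tl_position M 0 1 x -> exists2 z, move M y z & tl_position M 0 1 z) /\
    (tl_position M 1 0 x -> exists2 z, move M y z & tl_position M 1 0 z).

Definition forced (M : moveset) (lam : seq nat) : Prop :=
  forall x y, position M lam x -> move M x y ->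
    (tl_position M 0 1 x -> tl_position M 1 0 y) /\
    (tl_position M 1 0 x -> tl_position M 0 1 y).

Definition pet (M : moveset) (lam : seq nat) : Prop :=
  forall x, position M lam x ->
    [\/ tl_position M 0 1 x, tl_position M 1 0 x
      | exists2 k, 2 <= k & tl_position M k k x].

Definition family_has (Q : moveset -> seq nat -> Prop)
    (M : moveset) (P : seq nat -> Prop) : Prop :=
  forall lam, P lam -> Q M lam.

Definition family_fails (Q : moveset -> seq nat -> Prop)
    (M : moveset) (P : seq nat -> Prop) : Prop :=
  exists2 lam, P lam & ~ Q M lam.

Definition rectangle (s : seq nat) : Prop :=
  exists r c, [/\ 1 <= r, 1 <= c & s = nseq r c].

Definition staircase (s : seq nat) : Prop :=
  exists2 k, 1 <= k & s = rev (iota 1 k).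

Definition gen_staircase (r c k : nat) : seq nat :=
  flatten [seq nseq r (m * c) | m <- rev (iota 1 k)].

Definition subpart_gen_staircase (s : seq nat) : Prop :=
  exists r c k i j,
    [/\ [&& 1 <= r, 1 <= c & 1 <= k],
        s = subpart (gen_staircase r c k) i j & s != [::]].

Example gen_staircase_ex : gen_staircase 2 3 3 = [:: 9; 9; 6; 6; 3; 3].
Proof. by []. Qed.

Lemma Yplus_rectangle s : rectangle s -> Yplus s.
Proof.
case=> [[|r] [c [// _ c_gt0 ->]]]; rewrite /Yplus /is_partition andbT.
apply/andP; split; last by apply/allP => x /nseqP[->].
by rewrite /=; elim: r => //= r ->; rewrite leqnn.
Qed.

Lemma gen_staircase_partition r c k :
  1 <= c -> is_partition (gen_staircase r c k).
Proof.
move=> c_gt0; rewrite /gen_staircase; apply/andP; split; last first.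
  apply/allP => x /flattenP[_ /mapP[m m_k ->] /nseqP[-> _]].
  by move: m_k; rewrite mem_rev mem_iota muln_gt0 c_gt0 andbT => /andP[].
have geq_tr : transitive geq by move=> y x z /= yx zy; apply: leq_trans zy yx.
rewrite sorted_pairwise //; elim: k => [|k IH] //.
rewrite -[k.+1]addn1 iotaD rev_cat /= pairwise_cat IH andbT add1n.
apply/andP; split.
  apply/allrelP => x y /nseqP[-> _] /flattenP[_ /mapP[m m_k ->] /nseqP[-> _]].
  move: m_k; rewrite mem_rev mem_iota /= => /andP[_ lt_m].
  by rewrite leq_mul2r ltnW ?orbT.
by elim: r {IH} => //= r ->; rewrite andbT; apply/allP => x /nseqP[-> _] /=.
Qed.

Lemma Yplus_staircase s : staircase s -> Yplus s.
Proof.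
case=> k k_gt0 ->; apply/andP; split.
  have -> : rev (iota 1 k) = gen_staircase 1 1 k.
    rewrite /gen_staircase; elim: (rev _) => //= m t <-.
    by rewrite muln1.
  exact: gen_staircase_partition.
by rewrite -size_eq0 size_rev size_iota -lt0n.
Qed.

Lemma Yplus_subpart_gen_staircase s : subpart_gen_staircase s -> Yplus s.
Proof.
case=> r [c [k [i [j [/and3P[_ c_gt0 _] -> ne]]]]].
by rewrite /Yplus ne andbT subpart_partition // gen_staircase_partition.
Qed.

(* Main.v *)
Require Import Defs.
From mathcomp Require Import all_boot.
From mathcomp Require Import zify.
From Stdlib Require Import Relation_Operators.

(* Call a position of colour 0, 1 or 2 according as it is a (0,1)-position, a
   (1,0)-position or a (k,k)-position with k >= 2.  These colours obey their own
   recursion (2 if options of both colours 0 and 1 are present, else 1 if colour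
   0 is, else 0), and a game is pet exactly when no nonterminal position has all
   its options of colour 2.  For each family an explicit colouring with these
   properties is exhibited.  Pet implies returnable: in a pet game a position of
   Grundy value 0 is a (0,1)-position, one of misere value 0 a (1,0)-position,
   and from a nonterminal option of such a position the mex rule provides a move
   back to that value. *)

Set Implicit Arguments.
Unset Strict Implicit.
Unset Printing Implicit Defensive.

(** * Mex and the colour recursion *)

Lemma mex_unique l n : n \notin l -> (forall m, m < n -> m \in l) -> mex l = n.
Proof.
move=> nl lt_n; have [ml lt_m] := mexP l; case: (ltngtP (mex l) n) => // lt.
  by rewrite lt_n in ml.
by rewrite lt_m in nl.
Qed.

Lemma eq_mem_mex l1 l2 : l1 =i l2 -> mex l1 = mex l2.
Proof.
move=> eq_l; have [ml lt_m] := mexP l2.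
by apply: mex_unique => [|m]; rewrite eq_l //; apply: lt_m.
Qed.

(** Every colour from 2 on stands for all (k,k)-positions at once; the value [k] is not recorded. *)
Definition pet_class (M : moveset) (c : nat) (mu : seq nat) : Prop :=
  match c with
  | 0 => tl_position M 0 1 mu
  | 1 => tl_position M 1 0 mu
  | _ => exists2 k, 2 <= k & tl_position M k k mu
  end.

(** Options of colour 2 are ignored, since they supply neither 0 nor 1 to either mex. The empty list
    gives 0, the colour of terminal positions. *)
Definition color_mex (l : seq nat) : nat :=
  if 0 \in l then if 1 \in l then 2 else 1 else 0.

(** [l] collects the colours of the options. Below 2, their normal values are these colours and
    their misere values are the same with 0 and 1 exchanged. The last hypothesis excludes a
    nonterminal position with all options of colour 2, whose values would be (0,0). *)
Lemma pet_class_step M c l mu : is_partition mu ->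
    (forall nu, move M mu nu -> exists2 d, d \in l & pet_class M d nu) ->
    (forall d, d \in l -> exists2 nu, move M mu nu & pet_class M d nu) ->
    c = color_mex l -> (l == [::]) || has (fun d => d < 2) l ->
  pet_class M c mu.
Proof.
move=> mu_part mvl lmv cE; case: (altP (l =P [::])) => [l0 _|_ /= /hasP[d0 d0l d0_lt2]].
  have opt0 : options M mu = [::].
    apply/eqP; rewrite -[_ == _]negbK -size_eq0 -lt0n; apply/negP => /(mem_nth [::]).
    by case/(optionsP _ _ mu_part)/mvl => d; rewrite l0.
  rewrite cE l0 /=; split; by rewrite /sprague_grundy /misere_grundy grundyE opt0.
pose g t := [seq grundy M t nu | nu <- options M mu].
have gE t : grundy M t mu = mex (g t).
  rewrite grundyE /g; have [nu mv_nu _] := lmv _ d0l.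
  by have /(optionsP _ _ mu_part) := mv_nu; case: (options M mu).
have memg t n : reflect (exists2 nu, move M mu nu & grundy M t nu = n) (n \in g t).
  apply: (iffP mapP) => [[nu /(optionsP _ _ mu_part) mv ->]|[nu mv <-]]; first by exists nu.
  by exists nu => //; apply/optionsP.
have g0 d : d < 2 -> (d \in g 0) = (d \in l).
  move=> d2; apply/memg/idP => [[nu /mvl[e el]]|/lmv[nu mv cl]].
    case: e el => [|[|e]] el => [[sg _]|[sg _]|[k k2 [sg _]]];
      rewrite -[grundy M 0 nu]/(sprague_grundy M nu) sg.
    - by move<-.
    - by move<-.
    - by lia.
  by exists nu => //; case: d d2 cl => [|[|]] // _ [].
have g1 d : d < 2 -> (d \in g 1) = (1 - d \in l).
  move=> d2; apply/memg/idP => [[nu /mvl[e el]]|/lmv[nu mv cl]].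
    case: e el => [|[|e]] el => [[_ sg]|[_ sg]|[k k2 [_ sg]]];
      rewrite -[grundy M 1 nu]/(misere_grundy M nu) sg.
    - by move<-.
    - by move<-.
    - by lia.
  by exists nu => //; case: d d2 cl => [|[|]] // _ [].
have {d0l} : (0 \in l) || (1 \in l).
  by case: d0 d0l d0_lt2 => [|[|]] // -> //; rewrite orbT.
rewrite cE /color_mex; case l0 : (0 \in l); case l1 : (1 \in l) => // _; last first.
- by split; rewrite /sprague_grundy /misere_grundy gE;
    apply: mex_unique => [|[|[]]] //; rewrite ?g0 ?g1 ?l0 ?l1.
- by split; rewrite /sprague_grundy /misere_grundy gE;
    apply: mex_unique => [|[|[]]] //; rewrite ?g0 ?g1 ?l0 ?l1.
(* Both colours 0 and 1 occur, so the mex is at least 2; the two mexes agree because the two sets of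
   option values do. *)
exists (mex (g 0)).
  rewrite leqNgt; apply/negP => lt2; have [] := mexP (g 0).
  by rewrite g0 //; case: (mex _) lt2 => [|[|]] //; rewrite ?l0 ?l1.
split; rewrite /sprague_grundy /misere_grundy gE //; apply: eq_mem_mex => n.
case: (ltnP n 2) => [lt2|le2].
  by rewrite g0 ?g1 //; case: n lt2 => [|[|]] //; rewrite l0 l1.
(* For [n >= 2], an option of colour 0 or 1 has neither value equal to [n], and one of colour 2 has
   equal values. *)
have eqg nu : move M mu nu -> grundy M 0 nu = n <-> grundy M 1 nu = n.
  case/mvl=> [[|[|d]] _].
  - by case; rewrite /sprague_grundy /misere_grundy => -> ->; lia.
  - by case; rewrite /sprague_grundy /misere_grundy => -> ->; lia.
  - by case=> k _ []; rewrite /sprague_grundy /misere_grundy => -> ->.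
by apply/memg/memg => -[nu mv /(eqg nu mv) ?]; exists nu.
Qed.

(** Positions are handled through parameters in [S]. [succ] may list parameters outside [V], such as
    those of empty partitions; they are filtered out. Colours are correct by induction on the sum of
    the parts. *)
Lemma pet_by_coloring (M : moveset) (S : eqType) (V : pred S)
    (part : S -> seq nat) (succ : S -> seq S) (col : S -> nat) :
    (forall s, V s -> is_partition (part s)) ->
    (forall s t, V s ->
       move M (part s) t <-> exists s', [/\ s' \in succ s, V s' & t = part s']) ->
    (forall s, V s ->
       let l := [seq col s' | s' <- succ s & V s'] in
       col s = color_mex l /\ (l == [::]) || has (fun d => d < 2) l) ->
  forall s, V s -> pet M (part s).
Proof.
move=> part_ok moveE colE.
have classE n s : V s -> sumn (part s) < n -> pet_class M (col s) (part s).
  elim: n s => // n IH s Vs lt_n; have [cE c2] := colE s Vs.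
  have lt_move t : move M (part s) t -> sumn t < n.
    by move/(optionsP _ _ (part_ok s Vs))/options_sumn/leq_trans; apply.
  apply: (pet_class_step (part_ok s Vs) _ _ cE c2) => [nu mv|d /mapP[s']].
    have /(moveE s _ Vs)[s' [s's Vs' nuE]] := mv.
    exists (col s'); first by apply: map_f; rewrite mem_filter Vs'.
    by rewrite nuE; apply: IH; rewrite // -nuE lt_move.
  rewrite mem_filter => /andP[Vs' s's] ->.
  have mv : move M (part s) (part s') by apply/(moveE s _ Vs); exists s'.
  by exists (part s') => //; apply: IH => //; apply: lt_move.
move=> s Vs x pos_x.
have {pos_x} [s' Vs' ->] : exists2 s', V s' & x = part s'.
  have : exists2 s', V s' & part s = part s' by exists s.
  elim: pos_x => [y z mv [s' Vs' yE]|//|y z t _ IH1 _ IH2 /IH1/IH2 //].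
  by move: mv; rewrite yE => /(moveE _ _ Vs')[s'' [_ ? ?]]; exists s''.
have := classE _ _ Vs' (leqnn _); case: (col s') => [|[|c]] /=.
- by constructor 1.
- by constructor 2.
- by constructor 3.
Qed.

(** * From pet to returnable, and a criterion for not forced *)

Lemma move_partition M mu nu : is_partition mu -> move M mu nu -> is_partition nu.
Proof. by move=> mu_part [i [j [_ -> _]]]; apply: subpart_partition. Qed.

Lemma position_partition M lam mu :
  is_partition lam -> position M lam mu -> is_partition mu.
Proof.
move=> lam_part pos; elim: pos lam_part => [x y mv xp|//|x y z _ IH1 _ IH2 /IH1/IH2 //].
exact: move_partition mv.
Qed.

(** The move to [nu] makes [mu] nonterminal, so its value is a mex; a terminal position has value
    [t] with no options below it. *)
Lemma grundy_option M t mu nu m : is_partition mu ->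
  move M mu nu -> m < grundy M t mu -> exists2 xi, move M mu xi & grundy M t xi = m.
Proof.
move=> mu_part mv; rewrite grundyE; have := mv => /(optionsP _ _ mu_part).
case E: (options M mu) => [//|x s] _; rewrite -E => /(proj2 (mexP _))/mapP[xi].
by move/(optionsP _ _ mu_part); exists xi.
Qed.

Lemma grundy_move_neq M t mu nu : is_partition mu ->
  move M mu nu -> grundy M t nu != grundy M t mu.
Proof.
move=> mu_part mv; have /(optionsP _ _ mu_part) nu_opt := mv.
rewrite [grundy M t mu]grundyE; case E: (options M mu) nu_opt => [//|x s]; rewrite -E => nu_opt.
by apply: contra (proj1 (mexP [seq grundy M t xi | xi <- options M mu])) => /eqP <-; apply: map_f.
Qed.

Lemma pet_returnable M lam : is_partition lam -> pet M lam -> returnable M lam.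
Proof.
move=> lam_part pet_lam x y pos_x mv_xy y_nonterm.
have x_part := position_partition lam_part pos_x.
have y_part := move_partition x_part mv_xy.
have [w mv_yw] : exists w, move M y w.
  case E: (options M y) => [|w s].
    by case: y_nonterm => w /(optionsP _ _ y_part); rewrite E.
  by exists w; apply/(optionsP _ _ y_part); rewrite E mem_head.
have pos z : move M y z -> position M lam z.
  move=> mv; apply: rt_trans pos_x _; apply: rt_trans (rt_step _ _ _ _ mv).
  exact: rt_step.
split=> -[sgx mix].
  have := grundy_move_neq 0 x_part mv_xy; rewrite -/(sprague_grundy M x) sgx -lt0n.
  case/(grundy_option y_part mv_yw) => z mv_yz gz; exists z => //.
  by case: (pet_lam z (pos z mv_yz)) => // [[sg _]|[k k2 [sg _]]];
    rewrite /sprague_grundy gz in sg; lia.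
have := grundy_move_neq 1 x_part mv_xy; rewrite -/(misere_grundy M x) mix -lt0n.
case/(grundy_option y_part mv_yw) => z mv_yz gz; exists z => //.
by case: (pet_lam z (pos z mv_yz)) => // [[_ sg]|[k k2 [_ sg]]];
  rewrite /misere_grundy gz in sg; lia.
Qed.

(** By petness, unequal values make [x] a (0,1)- or (1,0)-position; equal values make its option [y]
    neither, so the game from [x] is not forced. The conditions on [x] and [y] can be checked by
    computation. *)
Lemma pet_returnable_not_forced M (P : seq nat -> Prop) x y :
    (forall lam, P lam -> is_partition lam /\ pet M lam) ->
    P x -> y \in options M x ->
    sprague_grundy M x != misere_grundy M x ->
    sprague_grundy M y == misere_grundy M y ->
  [/\ family_has pet M P, family_has returnable M P & family_fails forced M P].
Proof.
move=> petP Px xy sx sy; split=> [lam /petP[]|lam /petP[]|] //.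
  exact: pet_returnable.
exists x => // fx; have [x_part pet_x] := petP x Px.
have /(optionsP _ _ x_part) mv := xy.
have [f01 f10] := fx x y (rt_refl _ _ _) mv.
case: (pet_x x (rt_refl _ _ _)) => [/f01|/f10|[k _ [sgx mix]]].
- by case=> sg mi; rewrite sg mi in sy.
- by case=> sg mi; rewrite sg mi in sy.
- by rewrite sgx mix eqxx in sx.
Qed.

(** * Partitions as zero-padded sequences *)

Lemma nth_partition_le s i j : is_partition s -> i <= j -> nth 0 s j <= nth 0 s i.
Proof.
case/andP=> s_sorted _ le_ij; case: (ltnP j (size s)) => lt_j; last by rewrite nth_default.
apply: (sorted_leq_nth _ _ 0 s_sorted) => //.
- by move=> y x z /= yx zy; apply: leq_trans zy yx.
- exact: leqnn.
- by rewrite inE (leq_ltn_trans le_ij).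
Qed.

Lemma partition_nth_gt0 s i : is_partition s -> (0 < nth 0 s i) = (i < size s).
Proof.
case/andP=> _ /all_nthP s_gt0; case: (ltnP i (size s)) => [/s_gt0 -> //|le_s].
by rewrite nth_default.
Qed.

(** Parts are positive and the padding is 0, so the padded sequence also determines the length. *)
Lemma eq_partition s t :
  is_partition s -> is_partition t -> (forall i, nth 0 s i = nth 0 t i) -> s = t.
Proof.
move=> sp tp eq_st; apply: (@eq_from_nth _ 0) => [|i _]; last exact: eq_st.
have eq_lt i : (i < size s) = (i < size t) by rewrite -!partition_nth_gt0 // eq_st.
by have := eq_lt (size s); have := eq_lt (size t); lia.
Qed.

Lemma partition_neq_nil s : is_partition s -> (s != [::]) = (0 < nth 0 s 0).
Proof. by move=> sp; rewrite partition_nth_gt0 // lt0n size_eq0. Qed.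

(** In a decreasing sequence the filter only cuts off a tail, where truncated subtraction agrees
    with the default 0. *)
Lemma nth_subpart s i j n : is_partition s -> nth 0 (subpart s i j) n = nth 0 s (i + n) - j.
Proof.
move=> sp; rewrite /subpart -nth_drop.
have : forall a b, a <= b -> nth 0 (drop i s) b <= nth 0 (drop i s) a.
  by move=> a b le_ab; rewrite !nth_drop nth_partition_le // leq_add2l.
elim: (drop i s) n => [|x t IH] n le_t; first by rewrite nth_nil.
rewrite /= subn_gt0; case: (ltnP j x) => [lt_j|le_x].
  case: n => //= n; apply: IH => a b le_ab; exact: (le_t a.+1 b.+1).
have t_le m : nth 0 t m <= j by apply: leq_trans (le_t 0 m.+1 _) _.
have -> : [seq y <- [seq y - j | y <- t] | 0 < y] = [::].
  apply/eqP; rewrite -size_eq0 size_filter -leqn0 leqNgt -has_count has_map.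
  by apply/hasPn => y /(nthP 0)[m _ <-] /=; have := t_le m; lia.
by rewrite nth_nil; have := le_t 0 n isT => /=; lia.
Qed.

Lemma subpart_subpart s i j a b :
  is_partition s -> subpart (subpart s i j) a b = subpart s (i + a) (j + b).
Proof.
move=> sp; have sp' := subpart_partition i j sp.
apply: eq_partition => [||n]; rewrite ?subpart_partition // !nth_subpart //.
by rewrite subnDA addnA.
Qed.

Lemma subpart_neq_nil s i j : is_partition s -> (subpart s i j != [::]) = (j < nth 0 s i).
Proof.
move=> sp; rewrite partition_neq_nil ?subpart_partition // nth_subpart //.
by rewrite addn0 subn_gt0.
Qed.

Lemma nth_gen_staircase r c k n : 0 < r -> nth 0 (gen_staircase r c k) n = (k - n %/ r) * c.
Proof.
move=> r_gt0; elim: k n => [|k IH] n; first by rewrite /gen_staircase nth_nil.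
have -> : gen_staircase r c k.+1 = nseq r (k.+1 * c) ++ gen_staircase r c k.
  by rewrite /gen_staircase -[k.+1]addn1 iotaD rev_cat /= add1n addn1.
rewrite nth_cat size_nseq nth_nseq; case: (ltnP n r) => [lt_n|le_r].
  by rewrite divn_small // subn0.
rewrite IH; congr (_ * _); rewrite -{2}(subnK le_r) divnDr ?dvdnn // divnn r_gt0.
by rewrite addn1 subSS.
Qed.

(** * The King on staircases *)

Lemma staircase_gen k : rev (iota 1 k) = gen_staircase 1 1 k.
Proof. by rewrite /gen_staircase; elim: (rev _) => //= m t <-; rewrite muln1. Qed.

Lemma staircase_partition k : is_partition (rev (iota 1 k)).
Proof. by rewrite staircase_gen gen_staircase_partition. Qed.

(** Removing a row or a column has the same effect, so a position is just a number. *)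
Lemma subpart_staircase k i j : subpart (rev (iota 1 k)) i j = rev (iota 1 (k - (i + j))).
Proof.
apply: eq_partition => [||n]; rewrite ?subpart_partition ?staircase_partition //.
rewrite nth_subpart ?staircase_partition // !staircase_gen !nth_gen_staircase // !divn1; lia.
Qed.

Lemma staircase_neq_nil k : (rev (iota 1 k) != [::]) = (0 < k).
Proof. by rewrite -size_eq0 size_rev size_iota lt0n. Qed.

(** The options of size [k] have sizes [k - 1] and [k - 2]. The colours run 0, 1, 2 periodically, so
    from size 3 on the options show the two other colours. *)
Lemma pet_King_staircase k : 0 < k -> pet King (rev (iota 1 k)).
Proof.
apply: (@pet_by_coloring King nat (fun k => 0 < k) (fun k => rev (iota 1 k))
  (fun k => [:: k - 1; k - 2]) (fun k => (k - 1) %% 3)) => {k}.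
- by move=> k _; apply: staircase_partition.
- move=> k t _; split=> [[i [j [/= Mij ->]]]|[k' [k'_in k'_gt0 ->]]].
    rewrite subpart_staircase staircase_neq_nil => kij.
    exists (k - (i + j)); split=> //.
    by move: Mij; rewrite !inE => /or3P[] /eqP[-> ->]; rewrite ?eqxx ?orbT.
  move: k'_in; rewrite !inE => /orP[] /eqP k'E; [exists 0, 1|exists 1, 1];
    by rewrite subpart_staircase staircase_neq_nil -k'E.
- move=> [//|[|[|[|k]]]] _ //=; rewrite !subSS !subn0 /=.
  have : k %% 3 < 3 by rewrite ltn_mod.
  have -> : k.+3 %% 3 = k %% 3 by rewrite -addn3 modnDr.
  have -> : k.+2 %% 3 = (k %% 3 + 2) %% 3 by rewrite modnDml addn2.
  have -> : k.+1 %% 3 = (k %% 3 + 1) %% 3 by rewrite modnDml addn1.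
  by case: (k %% 3) => [|[|[|]]].
Qed.

(** * The Knight on rectangles *)

(** [a] is the shorter side and [d] the excess of the longer one. The colour has period 3 in [a] and
    is constant for [d >= 2]. *)
Definition knight_mod_color (a d : nat) : nat :=
  match a %% 3 with
  | 0 => if d <= 1 then 1 else 2
  | 1 => 0
  | _ => if d == 0 then 0 else 1
  end.

(** Transposition exchanges the two Knight moves, so only the unordered pair of sides matters. *)
Definition knight_color (p : nat * nat) : nat :=
  knight_mod_color (minn p.1 p.2) (maxn p.1 p.2 - minn p.1 p.2).

Lemma knight_color_wide r d : knight_color (r, r + d) = knight_mod_color r d.
Proof. by rewrite /knight_color /=; congr knight_mod_color; lia. Qed.

Lemma knight_color_tall c d : knight_color (c + d, c) = knight_mod_color c d.
Proof. by rewrite /knight_color /=; congr knight_mod_color; lia. Qed.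

Lemma knight_mod_colorS3 a d : knight_mod_color a.+3 d = knight_mod_color a d.
Proof. by rewrite /knight_mod_color -addn3 modnDr. Qed.

(** The recursion at sides [a + 3] and [a + d + 4]: taking 1 from the short side and 2 from the long
    one leaves excess [d], the other move leaves excess [d + 2]. Periodicity reduces it to finitely
    many cases. *)
Lemma knight_mod_color_step a d :
  let l := [:: knight_mod_color a.+2 d; knight_mod_color a.+1 d.+2] in
  knight_mod_color a.+3 d.+1 = color_mex l /\ has (fun e => e < 2) l.
Proof.
elim/ltn_ind: a => -[|[|[|a]]] IH; try by case: d {IH} => [|[|d]].
by move: (IH a); rewrite !knight_mod_colorS3; apply; lia.
Qed.

(** The recursion at a square of side [a + 3], whose two options are transposes of each other. *)
Lemma knight_mod_color_diag a :
  let e := knight_mod_color a.+1 1 in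
  knight_mod_color a.+3 0 = color_mex [:: e; e] /\ e < 2.
Proof.
elim/ltn_ind: a => -[|[|[|a]]] IH //.
by move: (IH a); rewrite !knight_mod_colorS3; apply; lia.
Qed.

Lemma color_mexC a b : color_mex [:: a; b] = color_mex [:: b; a].
Proof. by rewrite /color_mex !inE ![_ || (_ == b)]orbC. Qed.

Lemma subpart_rectangle r c i j :
  subpart (nseq r c) i j = if j < c then nseq (r - i) (c - j) else [::].
Proof.
by rewrite /subpart drop_nseq map_nseq filter_nseq subn_gt0; case: (j < c); rewrite ?mul1n.
Qed.

Lemma rectangle_partition r c : 0 < c -> is_partition (nseq r c).
Proof.
by case: r => // r c_gt0; have /andP[] : Yplus (nseq r.+1 c) by apply: Yplus_rectangle; exists r.+1, c.
Qed.

Lemma pet_Knight_rectangle r c : 0 < r -> 0 < c -> pet Knight (nseq r c).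
Proof.
move=> r_gt0 c_gt0; suff petK : forall p, (0 < p.1) && (0 < p.2) -> pet Knight (nseq p.1 p.2).
  by apply: (petK (r, c)); rewrite /= r_gt0.
apply: (@pet_by_coloring Knight _ (fun p => (0 < p.1) && (0 < p.2)) (fun p => nseq p.1 p.2)
  (fun p => [:: (p.1 - 1, p.2 - 2); (p.1 - 2, p.2 - 1)]) knight_color) => {r c r_gt0 c_gt0}.
- by case=> r c /andP[_ c_gt0]; apply: rectangle_partition.
- case=> r c t /= /andP[r_gt0 c_gt0];
  split=> [[i [j [/= Mij ->]]]|[[r' c'] [/= k'_in /andP[r'_gt0 c'_gt0] ->]]].
    rewrite subpart_rectangle; case: (ltnP j c) => // lt_j.
    rewrite -size_eq0 size_nseq -lt0n => lt_i.
    exists (r - i, c - j); split; rewrite //= ?lt_i ?subn_gt0 //.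
    by move: Mij; rewrite !inE => /orP[] /eqP[-> ->]; rewrite eqxx ?orbT.
  move: k'_in; rewrite !inE => /orP[] /eqP[r'E c'E]; [exists 1, 2|exists 2, 1];
    by rewrite subpart_rectangle -subn_gt0 -c'E c'_gt0 -r'E -size_eq0 size_nseq -lt0n.
- case=> r c /= /andP[r_gt0 c_gt0].
  case: (ltngtP r c) => [lt_rc|lt_cr|eq_rc].
  + have [d cE] : exists d, c = r + d.+1 by exists (c - r.+1); lia.
    rewrite {}cE knight_color_wide {c c_gt0 lt_rc}.
    (* One row allows no move, two rows only the move (1,2), and from three rows on both moves
       exist. *)
    case: r r_gt0 => [//|[|[|r]]] _ //=.
      have -> : (2 - 1, 2 + d.+1 - 2) = (1, 1 + d) by congr pair; lia.
      by rewrite /= knight_color_wide.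
    have -> : (r.+3 - 1, r.+3 + d.+1 - 2) = (r.+2, r.+2 + d) by congr pair; lia.
    have -> : (r.+3 - 2, r.+3 + d.+1 - 1) = (r.+1, r.+1 + d.+2) by congr pair; lia.
    by rewrite /= !knight_color_wide; apply: knight_mod_color_step.
  + have [d rE] : exists d, r = c + d.+1 by exists (r - c.+1); lia.
    rewrite {}rE knight_color_tall {r r_gt0 lt_cr}.
    case: c c_gt0 => [//|[|[|c]]] _ /=.
    * by rewrite !andbF.
    * have -> : (2 + d.+1 - 2, 2 - 1) = (1 + d, 1) by congr pair; lia.
      by rewrite knight_color_tall.
    have -> : (c.+3 + d.+1 - 1, c.+3 - 2) = (c.+1 + d.+2, c.+1) by congr pair; lia.
    have -> : (c.+3 + d.+1 - 2, c.+3 - 1) = (c.+2 + d, c.+2) by congr pair; lia.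
    rewrite /= !knight_color_tall color_mexC orbF orbC.
    by have := knight_mod_color_step c d; rewrite /= orbF.
  + rewrite -{}eq_rc {c c_gt0}; have := knight_color_wide r 0; rewrite addn0 => ->.
    case: r r_gt0 => [//|[|[|r]]] _ //=.
    have -> : (r.+3 - 1, r.+3 - 2) = (r.+1 + 1, r.+1) by congr pair; lia.
    have -> : (r.+3 - 2, r.+3 - 1) = (r.+1, r.+1 + 1) by congr pair; lia.
    rewrite /= knight_color_wide knight_color_tall.
    by have [-> ->] := knight_mod_color_diag r.
Qed.

(** * The Pawn on all partitions *)

(** This is the colour recursion itself; both Pawn moves delete a column, so the first part is
    enough fuel [n]. *)
Fixpoint pawn_color (n : nat) (s : seq nat) : nat :=
  if n is n'.+1 then
    color_mex [seq pawn_color n' t | t <- [:: subpart s 0 1; subpart s 1 1] & t != [::]]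
  else 0.

(* The list of pairs is closed under the colour recursion, applied to three
   successive row suffixes of a partition, and it excludes (2, 2). *)
Lemma pawn_color_adjacent n s : is_partition s -> s != [::] -> nth 0 s 0 <= n ->
  if subpart s 1 0 == [::] then pawn_color n s < 2
  else (pawn_color n s, pawn_color n (subpart s 1 0)) \in
    [:: (0, 0); (0, 2); (2, 1); (1, 1); (1, 0)].
Proof.
elim: n s => [|n IH] s sp; first by rewrite partition_neq_nil // leqn0 lt0n => /negPf->.
move=> s_neq le_n; set t := subpart s 1 0; have tp : is_partition t by apply: subpart_partition.
(* The options of [s] are [s[0,1]] and [s[1,1]], those of [t] are [s[1,1]] and [s[2,1]]. The
   induction hypothesis controls both consecutive pairs among these three. *)
have := IH (subpart s 0 1) (subpart_partition 0 1 sp).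
have := IH (subpart s 1 1) (subpart_partition 1 1 sp).
rewrite !nth_subpart // !subpart_subpart // ?add0n ?addn0 ?addn1.
have h1 : nth 0 s 1 - 1 <= n by have := nth_partition_le sp (isT : 0 <= 1); lia.
have h0 : nth 0 s 0 - 1 <= n by lia.
have yx : subpart s 0 1 = [::] -> subpart s 1 1 = [::].
  by move=> x0; rewrite -(@subpart_subpart s 0 1 1 0 sp) x0.
have zy : subpart s 1 1 = [::] -> subpart s 2 1 = [::].
  by move=> y0; rewrite -(@subpart_subpart s 1 1 1 0 sp) y0.
have yt : t = [::] -> subpart s 1 1 = [::].
  by move=> t0; rewrite -(@subpart_subpart s 1 0 0 1 sp) -/t t0.
have tE i : subpart t i 1 = subpart s i.+1 1 by rewrite subpart_subpart // add1n.
rewrite /= !tE.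
case x0: (subpart s 0 1 == [::]) => /=.
  rewrite (yx (eqP x0)) (zy (yx (eqP x0))) /= => _ _.
  by case: (t == [::]).
case y0: (subpart s 1 1 == [::]) => /=.
  rewrite (eqP y0) (zy (eqP y0)) /= => _ IHx.
  have {}IHx := IHx isT h0.
  by move: IHx; case: (pawn_color n _) => [|[|]]; case: (t == [::]).
have -> : (t == [::]) = false by apply/eqP => t0; rewrite (yt t0) in y0.
case z0: (subpart s 2 1 == [::]) => /= IHy IHx; move: (IHy isT h1) (IHx isT h0).
  by case: (pawn_color n _) => [|[|]] // _; case: (pawn_color n _) => [|[|[|]]].
case: (pawn_color n _) => [|[|[|]]] //; case: (pawn_color n _) => [|[|[|]]] //;
case: (pawn_color n _) => [|[|[|]]] //.
Qed.

(** The colour equation holds by definition. The option [s[1,1]] is [s[0,1]] without its first row,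
    so [pawn_color_adjacent] keeps the options from all having colour 2. *)
Lemma pet_Pawn s : is_partition s -> s != [::] -> pet Pawn s.
Proof.
move=> sp s_neq.
pose V (p : nat * seq nat) := [&& is_partition p.2, p.2 != [::] & nth 0 p.2 0 <= p.1].
apply: (@pet_by_coloring Pawn _ V snd
  (fun p => [:: (p.1 - 1, subpart p.2 0 1); (p.1 - 1, subpart p.2 1 1)])
  (fun p => pawn_color p.1 p.2) _ _ _ (nth 0 s 0, s)); last by rewrite /V /= sp s_neq /=.
- by case=> n {s sp s_neq}s /and3P[].
- case=> n {s sp s_neq}s t /and3P[/= sp s_neq le_n];
  split=> [[i [j [/= Mij -> st_neq]]]|[[n' s'] [/= s'_in /and3P[/= s'p s'_neq _] ->]]].
    exists (n - 1, subpart s i j); split=> //.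
      by move: Mij; rewrite !inE => /orP[] /eqP[-> ->]; rewrite eqxx ?orbT.
    rewrite /V /= subpart_partition // st_neq nth_subpart //.
    have -> : j = 1 by move: Mij; rewrite !inE => /orP[] /eqP[].
    by apply: leq_sub2r; apply: leq_trans le_n; apply: nth_partition_le.
  by move: s'_in s'_neq; rewrite !inE => /orP[] /eqP[_ ->]; [exists 0, 1|exists 1, 1].
- case=> n {s sp s_neq}s /and3P[/= sp s_neq le_n].
  case: n le_n => [|n] le_n; first by move: s_neq; rewrite partition_neq_nil // lt0n -leqn0 le_n.
  have h i : nth 0 s i - 1 <= n by have := nth_partition_le sp (leq0n i); lia.
  have VE i : V (n, subpart s i 1) = (subpart s i 1 != [::]).
    by rewrite /V /= subpart_partition //= nth_subpart // addn0 h andbT.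
  rewrite /= subn1 /= !VE; split; first by case: (_ == _); case: (_ == _).
  have x_part := subpart_partition 0 1 sp.
  case x0: (subpart s 0 1 == [::]) => /=.
    have -> : subpart s 1 1 = [::] by rewrite -(@subpart_subpart s 0 1 1 0 sp) (eqP x0).
    by [].
  have := pawn_color_adjacent x_part (negbT x0); rewrite nth_subpart // => /(_ n (h 0)) /=.
  rewrite subpart_subpart //=; case: (_ == _) => /=; first by move->.
  by case: (pawn_color n _) => [|[|[|]]] //; case: (pawn_color n _) => [|[|[|]]].
Qed.

(** * Downright on subpartitions of generalized staircases *)

(* With [D = i + k c - j] and [m] its residue modulo [r + c], a corner of the
   staircase has [m = r], and for odd [r + c] the colour 2 fills exactly the
   diagonals [m = 0] issuing from the re-entrant corners. *)
Definition downright_color (r c k : nat) (p : nat * nat) : nat :=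
  let m := (p.1 + k * c - p.2) %% (r + c) in
  if odd (r + c) && (m == 0) then 2 else odd (m + r).

(** The cell [(i, j)] lies in the staircase exactly when the coordinates of its [r] by [c] block sum
    to less than [k]. *)
Lemma subpart_gen_staircase_neq_nil r c k i j : 0 < r -> 0 < c ->
  (subpart (gen_staircase r c k) i j != [::]) = (i %/ r + j %/ c < k).
Proof.
move=> r_gt0 c_gt0; rewrite subpart_neq_nil ?gen_staircase_partition //.
by rewrite nth_gen_staircase // -ltn_divLR // ltn_subRL.
Qed.

(** Moving down raises [m] by 1 modulo [N], moving right lowers it. Away from colour 2 both moves
    flip the parity of [m + r]; for odd [N] the neighbours 1 and [N - 1] of residue 0 have opposite
    parities, hence its colour 2. If both moves are blocked then [m = r], of colour 0. *)
Lemma downright_color_step m N r c (down right : bool) :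
    0 < r -> 0 < c -> N = r + c -> m < N ->
    (~~ down -> r <= m) -> (~~ down -> right -> r < m) ->
    (~~ right -> 0 < m <= r) -> (~~ right -> down -> m < r) ->
  let col x := if odd N && (x == 0) then 2 else odd (x + r) : nat in
  let l := (if down then [:: col (if m.+1 == N then 0 else m.+1)] else [::]) ++
           (if right then [:: col (if m == 0 then N.-1 else m.-1)] else [::]) in
  col m = color_mex l /\ (l == [::]) || has (fun d => d < 2) l.
Proof.
move=> r_gt0 c_gt0 NE lt_m d1 d2 r1 r2 col.
have col0 : col 0 = if odd N then 2 else odd r by rewrite /col andbT.
have downE : col (if m.+1 == N then 0 else m.+1) =
    if odd N && (m.+1 == N) then 2 else ~~ odd (m + r).
  case: eqP => [mN|_]; last by rewrite andbF /col /= andbF.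
  rewrite /col eqxx andbT /=; case oN: (odd N) => //.
  have om : odd m by rewrite -[odd m]negbK -oddS mN oN.
  by rewrite add0n oddD om addTb negbK.
have rightE : col (if m == 0 then N.-1 else m.-1) =
    if odd N && (m == 1) then 2 else (if odd N && (m == 0) then odd r else ~~ odd (m + r)) : nat.
  case: m lt_m {d1 d2 r1 r2 downE} => [|[|m]] lt_m /=.
  - rewrite andbF andbT /col; have -> : (N.-1 == 0) = false by lia.
    have := oddS N.-1; rewrite prednK; last by lia.
    rewrite andbF oddD => oN; case: (odd N) oN => /=; by case: (odd N.-1).
  - by rewrite andbF col0 oddD /= negbK andbT; case: (odd N).
  - by rewrite !andbF /col /= andbF negbK.
(* Hence [m = 1] and [m + 1 = N] cannot both hold, and no cell has two options of colour 2. *)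
have NN : odd N -> 2 < N.
  by case: N NE {lt_m col col0 downE rightE} => [|[|[|]]] // *; lia.
case: down d1 d2 r2; case: right r1 => r1 d1 d2 r2; rewrite /= ?downE ?rightE {downE rightE};
  rewrite /col /color_mex.
- case: (altP (m =P 0)) => [m0|m_neq0].
    rewrite m0 add0n /= !andbF andbT; case: (odd N) NN => [/(_ isT) N_gt2|_].
      have -> : (1 == N) = false by lia.
      by case: (odd r).
    by case: (odd r).
  rewrite !andbF; case: (odd N) NN => [/(_ isT) N_gt2|_]; last by case: (odd _).
  case: eqP => [mN|_]; last by case: (_ == 1); case: (odd _).
  have -> : (m == 1) = false by lia.
  by case: (odd _).
- have -> : (m == 0) = false by lia.
  have -> : (m.+1 == N) = false by have := r2 isT isT; lia.
  by rewrite !andbF; case: (odd _).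
- have := d2 isT isT => lt_r.
  have -> : (m == 0) = false by lia.
  have -> : (m == 1) = false by lia.
  by rewrite !andbF; case: (odd _).
- have -> : m = r by have := d1 isT; have := r1 isT; lia.
  have -> : (r == 0) = false by lia.
  by rewrite andbF addnn odd_double.
Qed.

Lemma modnS_small m d : 0 < d -> m.+1 %% d = if (m %% d).+1 == d then 0 else (m %% d).+1.
Proof.
move=> d_gt0; have lt_md := ltn_pmod m d_gt0; rewrite -addn1 -modnDml addn1.
case: eqP => [->|ne]; first by rewrite modnn.
by rewrite modn_small // ltn_neqAle lt_md andbT; apply/eqP.
Qed.

Lemma pet_Downright_gen_staircase r c k i j : 0 < r -> 0 < c -> i %/ r + j %/ c < k ->
  pet Downright (subpart (gen_staircase r c k) i j).
Proof.
move=> r_gt0 c_gt0 ij_lt; have gp := gen_staircase_partition r k c_gt0.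
pose V (p : nat * nat) := p.1 %/ r + p.2 %/ c < k.
pose part (p : nat * nat) := subpart (gen_staircase r c k) p.1 p.2.
apply: (@pet_by_coloring Downright _ V part
  (fun p => [:: (p.1.+1, p.2); (p.1, p.2.+1)]) (downright_color r c k) _ _ _ (i, j)) => // {i j ij_lt}.
- by move=> p _; apply: subpart_partition.
- case=> i j t _; split=> [[a [b [/= Mab ->]]]|[[i' j'] [/= p_in Vp ->]]].
    rewrite subpart_subpart // subpart_gen_staircase_neq_nil // => Vp.
    exists (i + a, j + b); split=> //; move: Mab; rewrite !inE.
    by case/orP => /eqP[-> ->]; rewrite ?addn0 ?addn1 eqxx ?orbT.
  move: p_in; rewrite !inE => /orP[] /eqP[iE jE]; [exists 1, 0|exists 0, 1];
    by rewrite /part /= subpart_subpart // ?addn0 ?addn1 -?iE -?jE subpart_gen_staircase_neq_nil.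
- case=> i j; rewrite /V /= => Vij.
  set N := r + c; have N_gt0 : 0 < N by rewrite addn_gt0 r_gt0.
  have lt_j : j < k * c by rewrite -ltn_divLR //; apply: leq_ltn_trans Vij; apply: leq_addl.
  set D := i + k * c - j.
  have D_gt0 : 0 < D by rewrite /D; lia.
  set col := fun x => if odd N && (x == 0) then 2 else odd (x + r) : nat.
  have downE : downright_color r c k (i.+1, j) =
      col (if (D %% N).+1 == N then 0 else (D %% N).+1).
    by rewrite -modnS_small // /D /col /downright_color /= -/N addSn subSn //; lia.
  have rightE : downright_color r c k (i, j.+1) =
      col (if D %% N == 0 then N.-1 else (D %% N).-1).
    rewrite -[_ == 0]/(N %| D) -modn_pred //; last by rewrite /N; lia.
    by rewrite /downright_color /= subnS.
  have [ir jc] : i %% r < r /\ j %% c < c by rewrite !ltn_pmod.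
  (* [g] counts the block steps left before the boundary; a move can be blocked only if [g = 0]. *)
  have [g kE] : exists g, k = i %/ r + j %/ c + g.+1 by exists (k - (i %/ r + j %/ c).+1); lia.
  have DE : D = (i %/ r) * N + (i %% r + g.+1 * c - j %% c).
    rewrite /D {1}(divn_eq i r) {1}(divn_eq j c) {1}kE !mulnDl mulnDr.
    have : c <= g.+1 * c by rewrite mulSn leq_addr.
    by lia.
  have downV : (i.+1 %/ r + j %/ c < k) = ~~ ((r %| i.+1) && (g == 0)).
    by rewrite divnS //; case: (r %| _); rewrite /= kE; lia.
  have rightV : (i %/ r + j.+1 %/ c < k) = ~~ ((c %| j.+1) && (g == 0)).
    by rewrite divnS //; case: (c %| _); rewrite /= kE; lia.
  have r_dvd : (r %| i.+1) = ((i %% r).+1 == r).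
    by rewrite /dvdn modnS_small //; case: (_.+1 == _).
  have c_dvd : (c %| j.+1) = ((j %% c).+1 == c).
    by rewrite /dvdn modnS_small //; case: (_.+1 == _).
  have modE : g = 0 -> D %% N = i %% r + c - j %% c.
    by move=> g0; rewrite DE g0 mul1n modnMDl; apply: modn_small; rewrite /N; clear -ir jc; lia.
  rewrite downV rightV r_dvd c_dvd {downV rightV r_dvd c_dvd}.
  have colE : downright_color r c k (i, j) = col (D %% N) by [].
  have lt_m := ltn_pmod D N_gt0.
  rewrite colE; move: downE rightE modE lt_m ir jc {DE colE Vij lt_j D_gt0}.
  move: (D %% N) (i %% r) (j %% c) => m i' j' downE rightE modE lt_m ir jc.
  have := @downright_color_step m N r c (~~ ((i'.+1 == r) && (g == 0)))
    (~~ ((j'.+1 == c) && (g == 0))) r_gt0 c_gt0 erefl lt_m.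
  rewrite !negbK -/col => step.
  (* In a boundary block [m = i' + c - j']: the last row gives [m >= r] and the last column
     [m = i' + 1 <= r], with equality only at the corner. *)
  have h1 : (i'.+1 == r) && (g == 0) -> r <= m.
    by case/andP=> /eqP i'E /eqP/modE; lia.
  have h2 : (i'.+1 == r) && (g == 0) -> ~~ ((j'.+1 == c) && (g == 0)) -> r < m.
    by case/andP=> /eqP i'E /eqP g0; rewrite g0 andbT (modE g0); lia.
  have h3 : (j'.+1 == c) && (g == 0) -> 0 < m <= r.
    by case/andP=> /eqP j'E /eqP/modE; lia.
  have h4 : (j'.+1 == c) && (g == 0) -> ~~ ((i'.+1 == r) && (g == 0)) -> m < r.
    by case/andP=> /eqP j'E /eqP g0; rewrite g0 andbT (modE g0); lia.
  have := step h1 h2 h3 h4.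
  by case: (_ && _); case: (_ && _) => /=; rewrite ?downE ?rightE.
Qed.

(** * The five families, with witnesses against forcedness *)

Theorem theorem4p9 :
  [/\ [/\ family_has pet Pawn Yplus, family_has returnable Pawn Yplus
        & family_fails forced Pawn Yplus],
      [/\ family_has pet Knight rectangle, family_has returnable Knight rectangle
        & family_fails forced Knight rectangle],
      [/\ family_has pet King staircase, family_has returnable King staircase
        & family_fails forced King staircase],
      [/\ family_has pet Pawn staircase, family_has returnable Pawn staircase
        & family_fails forced Pawn staircase]
    & [/\ family_has pet Downright subpart_gen_staircase,
          family_has returnable Downright subpart_gen_staircase
        & family_fails forced Downright subpart_gen_staircase]].
Proof.
have partY s : Yplus s -> is_partition s by case/andP.
split.
(* On staircases Pawn and King have the same options, and sizes 4 and 3 have colours 0 and 2. *)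
- apply: (@pet_returnable_not_forced Pawn _ [:: 4; 3; 2; 1] [:: 3; 2; 1]); [|by []|by vm_compute..].
  by move=> s /andP[sp s_neq]; split=> //; apply: pet_Pawn.
- apply: (@pet_returnable_not_forced Knight _ (nseq 4 7) (nseq 3 5));
    [|by exists 4, 7|by vm_compute..].
  by move=> s sR; split;
    [exact/partY/Yplus_rectangle|case: sR => r [c [? ? ->]]; exact: pet_Knight_rectangle].
- apply: (@pet_returnable_not_forced King _ [:: 4; 3; 2; 1] [:: 3; 2; 1]);
    [|by exists 4|by vm_compute..].
  by move=> s sS; split;
    [exact/partY/Yplus_staircase|case: sS => k ? ->; exact: pet_King_staircase].
- apply: (@pet_returnable_not_forced Pawn _ [:: 4; 3; 2; 1] [:: 3; 2; 1]);
    [|by exists 4|by vm_compute..].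
  by move=> s /Yplus_staircase/andP[sp s_neq]; split=> //; apply: pet_Pawn.
(* Here [r = 1] and [c = 2], so [r + c] is odd and colour 2 occurs: the residues are 1 and then
   0. *)
- apply: (@pet_returnable_not_forced Downright _ [:: 4; 2] [:: 3; 1]);
    [|by exists 1, 2, 2, 0, 0|by vm_compute..].
  move=> s sG; split; first exact/partY/Yplus_subpart_gen_staircase.
  case: sG => r [c [k [i [j [/and3P[r_gt0 c_gt0 _] ->]]]]].
  by rewrite subpart_gen_staircase_neq_nil // => ?; apply: pet_Downright_gen_staircase.
Qed.
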